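(* Let $A$ be a complex $n\times n$ matrix ($n\ge1$) and let $p$ be a monic polynomial with distinct roots $\Lambda=\{\lambda_1,\dots,\lambda_d\}$, $d\geq 1$, such that $B=p(A)$ is similar to a diagonal matrix. Then the mapping $$\chi_A:\ C_\Lambda(p(\sigma(A)))\to\mathbb M_n,\qquad \chi_A(f)=\sum_{j=1}^d\delta_j(A)f_j(B),$$ is a continuous homomorphism of algebras.
   Context: $\mathbb M_n$ is the algebra of complex $n\times n$ matrices with the operator norm induced by the Euclidean norm, and $\sigma(A)$ is the set of eigenvalues of $A$. Here $p(z)=(z-\lambda_1)\cdots(z-\lambda_d)$ and $\delta_j(z)=\prod_{k\neq j}\frac{z-\lambda_k}{\lambda_j-\lambda_k}$. For compact nonempty $M\subset\mathbb C$, $C_\Lambda(M)$ is the commutative unital Banach algebra of continuous functions $f:M\to\mathbb C^d$ with unit $\mathbf 1=(1,\dots,1)^t$ and product (polyproduct) given componentwise by $$(f\circledcirc g)_i(w)=f_i(w)g_i(w)-w\sum_{j\neq i}\frac{(f_i(w)-f_j(w))(g_i(w)-g_j(w))}{p'(\lambda_j)(\lambda_i-\lambda_j)},$$ and norm $\|f\|=\sup_{|g|_M\le1}|f\circledcirc g|_M$, where $|f|_M=\max_{w\in M}\max_j|f_j(w)|$. For $f_j$ defined on $\sigma(B)=p(\sigma(A))$ the matrix $f_j(B)$ is $Tf_j(D)T^{-1}$, where $B=TDT^{-1}$ with $D$ diagonal and $f_j$ is applied to the diagonal entries of $D$; equivalently $f_j(B)=q(B)$ for any polynomial $q$ agreeing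 with $f_j$ on $\sigma(B)$. *)

(* Defs.v *)
From HB Require Import structures.
From mathcomp Require Import all_boot all_order all_algebra.
From mathcomp Require Import ring.
From mathcomp Require Export complex.
From mathcomp Require Import all_classical all_reals all_analysis.

Set Implicit Arguments.
Unset Strict Implicit.
Unset Printing Implicit Defensive.

Import Order.TTheory GRing.Theory Num.Theory.
Import numFieldNormedType.Exports.

Local Open Scope classical_set_scope.
Local Open Scope ring_scope.

(* The complex numbers are [R[i]]; they get the metric topology of [R[i]^o]. *)
HB.instance Definition _ (R : realType) := NormedModule.copy R[i] R[i]^o.

Section PolyProduct.
Variables (F : fieldType) (d : nat) (lam : 'I_d -> F).
Implicit Types (u v x y : 'cV[F]_d) (w : F).

Definition root_poly : {poly F} := \prod_j ('X - (lam j)%:P).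

Definition delta_poly (j : 'I_d) : {poly F} :=
  \prod_(k | k != j) ((lam j - lam k)^-1 *: ('X - (lam k)%:P)).

(* The polyproduct at a point [w]. *)
Definition pprod w u v : 'cV[F]_d :=
  \col_i (u i 0 * v i 0
    - w * \sum_(j | j != i) ((u i 0 - u j 0) * (v i 0 - v j 0))
                            / (root_poly^`().[lam j] * (lam i - lam j))).

Definition pprod1 : 'cV[F]_d := const_mx 1.

Lemma pprodC w : commutative (pprod w).
Proof.
move=> u v; apply/colP => i; rewrite !mxE mulrC; congr (_ - _ * _).
by apply: eq_bigr => j _; rewrite [X in X / _]mulrC.
Qed.

Lemma pprod1l w : left_id pprod1 (pprod w).
Proof.
move=> u; apply/colP => i; rewrite !mxE mul1r big1 ?mulr0 ?subr0// => j _.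
by rewrite !mxE subrr !mul0r.
Qed.

Lemma pprodDl w : left_distributive (pprod w) +%R.
Proof.
move=> u v x; apply/colP => i; rewrite !mxE mulrDl.
rewrite (eq_bigr (fun j =>
  ((u i 0 - u j 0) * (x i 0 - x j 0))
     / (root_poly^`().[lam j] * (lam i - lam j)) +
  ((v i 0 - v j 0) * (x i 0 - x j 0))
     / (root_poly^`().[lam j] * (lam i - lam j)))); last first.
  by move=> j _; rewrite !mxE -mulrDl -mulrDl; congr (_ * _ / _); ring.
rewrite big_split /=; ring.
Qed.

Lemma pprodZl w c u v : pprod w (c *: u) v = c *: pprod w u v.
Proof.
apply/colP => i; rewrite !mxE mulrBr mulrA; congr (_ - _).
rewrite mulrCA; congr (_ * _); rewrite mulr_sumr; apply: eq_bigr => j _.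
by rewrite !mxE -mulrBr !mulrA.
Qed.

Hypothesis lam_inj : injective lam.

Let P := root_poly.
Let Pd (j : 'I_d) : {poly F} := \prod_(k | k != j) ('X - (lam k)%:P).
Let S u : {poly F} := \sum_j u j 0 *: delta_poly j.

Let size_P : size P = d.+1.
Proof. by rewrite /P /root_poly size_prod_XsubC /index_enum -enumT size_enum_ord. Qed.

Let PE j : P = ('X - (lam j)%:P) * Pd j.
Proof. by rewrite /P /root_poly (bigD1 j). Qed.

Let P'E j : P^`().[lam j] = (Pd j).[lam j].
Proof.
by rewrite (PE j) derivM derivXsubC mul1r hornerD hornerM hornerXsubC addrN
  mul0r addr0.
Qed.

Let Pd_neq0 j : (Pd j).[lam j] != 0.
Proof.
rewrite horner_prod; apply/prodf_neq0 => k kj.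
by rewrite hornerXsubC subr_eq0 (inj_eq lam_inj) eq_sym.
Qed.

Let deltaE j : delta_poly j = (Pd j).[lam j]^-1 *: Pd j.
Proof.
rewrite /delta_poly scaler_prod horner_prod prodfV; congr (_^-1 *: _).
by apply: eq_bigr => k _; rewrite hornerXsubC.
Qed.

Let delta_eval i j : (delta_poly j).[lam i] = (i == j)%:R.
Proof.
have [->|ij] := eqVneq i j; first by rewrite deltaE hornerZ mulVf.
rewrite deltaE hornerZ [X in _ * X](_ : _ = 0) ?mulr0//.
by rewrite /Pd (bigD1 i) //= hornerM hornerXsubC subrr mul0r.
Qed.

Let S_eval u i : (S u).[lam i] = u i 0.
Proof.
rewrite horner_sum (bigD1 i) //= hornerZ delta_eval eqxx mulr1 big1 ?addr0//.
by move=> j ji; rewrite hornerZ delta_eval eq_sym (negPf ji) mulr0.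
Qed.

Let size_delta j : (size (delta_poly j) <= d)%N.
Proof.
rewrite deltaE (leq_trans (size_scale_leq _ _))//.
have Pd0 : Pd j != 0.
  by apply: contraTneq (Pd_neq0 j) => ->; rewrite horner0 eqxx.
by have := size_P; rewrite (PE j) size_monicM ?monicXsubC// size_XsubC => /eq_add_S <-.
Qed.

Let size_S u : (size (S u) <= d)%N.
Proof.
apply: (leq_trans (size_sum _ _ _)); apply/bigmax_leqP => j _.
by rewrite (leq_trans (size_scale_leq _ _)).
Qed.

Let eq_small (q r : {poly F}) : (size q <= d)%N -> (size r <= d)%N ->
  (forall i, q.[lam i] = r.[lam i]) -> q = r.
Proof.
move=> sq sr qr; apply/eqP; rewrite -subr_eq0; apply/eqP.
apply: (@roots_geq_poly_eq0 _ _ [seq lam i | i <- enum 'I_d]).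
- by apply/allP => x /mapP[i _ ->]; rewrite /root !hornerE qr subrr.
- by rewrite map_inj_uniq ?enum_uniq.
- by rewrite size_map size_enum_ord (leq_trans (size_polyD _ _))// geq_max
    size_polyN sq.
Qed.

Let S1 : (0 < d)%N -> S pprod1 = 1.
Proof.
move=> d_gt0; apply: eq_small => //; first by rewrite size_poly1.
by move=> i; rewrite S_eval mxE hornerC.
Qed.

Let a i j := (P^`().[lam j] * (lam i - lam j))^-1.

Let delta_mul i j : i != j ->
  delta_poly i * delta_poly j
    = P * (a i j *: delta_poly i + a j i *: delta_poly j).
Proof.
move=> ij; have ji : j != i by rewrite eq_sym.
pose Q := \prod_(k | (k != i) && (k != j)) ('X - (lam k)%:P).
have Ei : Pd i = ('X - (lam j)%:P) * Q by rewrite /Pd (bigD1 j).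
have Ej : Pd j = ('X - (lam i)%:P) * Q.
  by rewrite /Pd (bigD1 i) //=; congr (_ * _); apply: eq_bigl => k; rewrite andbC.
have E : ((lam i - lam j)^-1)%:P * ((lam i)%:P - (lam j)%:P) = 1.
  by rewrite -polyCB -polyCM mulVf// subr_eq0 (inj_eq lam_inj).
rewrite /a -[lam j - lam i]opprB !P'E !deltaE mulrN !invfM invrN invfM.
rewrite -!mul_polyC !polyCN !polyCM (PE i) Ei Ej.
set e := ((lam i - lam j)^-1)%:P in E *.
set ci := (_^-1)%:P; set cj := (_ ^-1)%:P.
transitivity (ci * cj * ('X - (lam i)%:P) * ('X - (lam j)%:P) * Q * Q *
  (e * ((lam i)%:P - (lam j)%:P))); last by ring.
by rewrite E; ring.
Qed.

Let s u v i := \sum_(j | j != i) ((u i 0 - u j 0) * (v i 0 - v j 0)) * a i j.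

Lemma delta_sum_mul u v :
  (\sum_j u j 0 *: delta_poly j) * (\sum_j v j 0 *: delta_poly j) =
  \sum_j (u j 0 * v j 0) *: delta_poly j
  - root_poly * \sum_j
      (\sum_(k | k != j) ((u j 0 - u k 0) * (v j 0 - v k 0))
          / (root_poly^`().[lam k] * (lam j - lam k))) *: delta_poly j.
Proof.
case: (posnP d) => [d0|d_gt0].
  have E (G : 'I_d -> {poly F}) : \sum_j G j = 0.
    by apply: big1 => i; have := ltn_ord i; rewrite {2}d0.
  by rewrite !E !mulr0 subrr.
rewrite -/P; set X := LHS; set A := (Y in _ = Y - _); set B := (Y in _ = _ - Y).
suff E : A - X = B by rewrite -E subKr.
rewrite {}/A {}/B {}/X.
have -> : \sum_j (u j 0 * v j 0) *: delta_poly j =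
    \sum_i \sum_j (u i 0 * v i 0) *: (delta_poly i * delta_poly j).
  apply: eq_bigr => i _; rewrite -scaler_sumr -mulr_sumr.
  have := S1 d_gt0; rewrite /S (eq_bigr delta_poly) ?mulr1 => [->|k _].
    by rewrite mulr1.
  by rewrite mxE scale1r.
rewrite mulr_suml -sumrB.
transitivity (P * (\sum_i \sum_(j | j != i)
    ((u i 0 * (v i 0 - v j 0)) *: (a i j *: delta_poly i + a j i *: delta_poly j)))).
  rewrite mulr_sumr; apply: eq_bigr => i _.
  rewrite [X in _ - X]mulr_sumr -sumrB (bigD1 i) //=.
  rewrite -scalerAl -scalerAr scalerA subrr add0r mulr_sumr.
  apply: eq_bigr => j ji; rewrite -scalerAl -scalerAr scalerA -scalerBl -mulrBr.
  by rewrite delta_mul 1?eq_sym// scalerAr.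
congr (_ * _).
under eq_bigr => i _ do (under eq_bigr => j _ do rewrite scalerDr; rewrite big_split /=).
rewrite big_split /=.
rewrite [X in _ + X](exchange_big_dep xpredT) //= -big_split /=.
apply: eq_bigr => i _; rewrite scaler_suml.
rewrite [X in _ + X](eq_bigl (fun j => j != i)); last by move=> j; rewrite eq_sym.
rewrite -big_split /=; apply: eq_bigr => j _.
by rewrite !scalerA -scalerDl -mulrDl; congr (_ * _ *: _); ring.
Qed.

Let S_pprod w u v : exists Q, S u * S v - S (pprod w u v) = (w%:P - P) * Q.
Proof.
exists (\sum_j (s u v j) *: delta_poly j).
have -> : S (pprod w u v) = \sum_j (u j 0 * v j 0) *: delta_poly j
    - w *: \sum_j s u v j *: delta_poly j.
  rewrite scaler_sumr -sumrB; apply: eq_bigr => j _.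
  by rewrite mxE scalerBl scalerA.
rewrite [S u * S v]delta_sum_mul -/P -mul_polyC.
rewrite -[X in _ - P * X]/(\sum_j s u v j *: delta_poly j); ring.
Qed.

Lemma pprodA w : associative (pprod w).
Proof.
move=> u v x.
suff E : S (pprod w u (pprod w v x)) = S (pprod w (pprod w u v) x).
  by apply/colP => i; rewrite -!S_eval E.
have [Q1 E1] := S_pprod w v x; have [Q2 E2] := S_pprod w u (pprod w v x).
have [Q3 E3] := S_pprod w u v; have [Q4 E4] := S_pprod w (pprod w u v) x.
set L := S (pprod w u _) in E2 *; set R := S (pprod w _ x) in E4 *.
pose Q := S u * Q1 + Q2 - Q3 * S x - Q4.
have E : L - R = - (w%:P - P) * Q.
  have -> : - (w%:P - P) * Q = - (S u * ((w%:P - P) * Q1) + (w%:P - P) * Q2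
    - (w%:P - P) * Q3 * S x - (w%:P - P) * Q4) by rewrite /Q; ring.
  by rewrite -E1 -E2 -E3 -E4; ring.
have [Q0|Q0] := eqVneq Q 0; first by apply/eqP; rewrite -subr_eq0 E Q0 mulr0.
case: (posnP d) => [d0|d_gt0].
  by rewrite /L /R /S !big1// => i; have := ltn_ord i; rewrite {2}d0.
have sP : size (- (w%:P - P)) = d.+1.
  rewrite opprB size_polyDl size_P// size_polyN.
  by rewrite (leq_ltn_trans (size_polyC_leq1 _)).
have := leq_trans (size_polyD L (- R)).
move/(_ d); rewrite geq_max size_polyN !size_S => /(_ isT).
rewrite E size_mul// -?size_poly_eq0 ?sP// addSn /= leqNgt.
by rewrite -[X in (X < _)%N]addn0 ltn_add2l size_poly_gt0 Q0.
Qed.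

End PolyProduct.

Section PointwiseContinuity.
Variables (R : realType) (d : nat) (T : topologicalType).
Implicit Types f g : T -> 'cV[R[i]]_d.

Lemma cont_cV f : (forall i, continuous (fun x => f x i 0)) -> continuous f.
Proof.
move=> cf x; apply/cvg_ballP => e e0; rewrite near_simpl.
have : \forall y \near x, forall i, ball (f x i 0) e (f y i 0).
  apply: filter_forall => i; have /cvg_ballP/(_ _ e0) := cf i x.
  by rewrite near_simpl.
by apply: filterS => y H; split=> // i j; rewrite ord1; exact: H.
Qed.

Lemma cont_coord f i : continuous f -> continuous (fun x => f x i 0).
Proof.
move=> cf x; apply: (@continuous_comp _ _ _ f (fun A : 'cV_d => A i 0)).
  exact: cf.
exact: coord_continuous.
Qed.

Lemma cont_opp f : continuous f -> continuous (fun x => - f x).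
Proof.
move=> cf; apply: cont_cV => i x; under eq_fun do rewrite mxE.
by apply: cvgN; exact: cont_coord.
Qed.

Lemma cont_add f g : continuous f -> continuous g ->
  continuous (fun x => f x + g x).
Proof.
move=> cf cg; apply: cont_cV => i x; under eq_fun do rewrite mxE.
by apply: cvgD; exact: cont_coord.
Qed.

Lemma cont_scale c f : continuous f -> continuous (fun x => c *: f x).
Proof.
move=> cf; apply: cont_cV => i x; under eq_fun do rewrite mxE.
by apply: cvgM; [exact: cvg_cst|exact: cont_coord].
Qed.

Lemma cont_pprod (lam : 'I_d -> R[i]) (h : T -> R[i]) f g :
  continuous h -> continuous f -> continuous g ->
  continuous (fun x => pprod lam (h x) (f x) (g x)).
Proof.
move=> ch cf cg; apply: cont_cV => i x; under eq_fun do rewrite mxE.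
apply: cvgB; first by apply: cvgM; exact: cont_coord.
apply: cvgM; first exact: ch.
apply: cvg_big => [|j _]; first exact: add_continuous.
apply: cvgM; last exact: cvg_cst.
by apply: cvgM; apply: cvgB; exact: cont_coord.
Qed.

End PointwiseContinuity.

Section CLambda.
Variables (R : realType) (d : nat) (lam : 'I_d -> R[i]).

(* The polyproduct is associative because the roots are distinct, so [lam_inj] *)
(* is a phantom parameter of the type, used by the ring instance.             *)
(* Compactness and nonemptiness of [M] play no role until the norms below.    *)
Definition CLambda (lam_inj : injective lam) (M : set R[i]) : Type :=
  continuousType M 'cV[R[i]]_d.

Variables (lam_inj : injective lam) (M : set R[i]).
Local Notation CL := (CLambda lam_inj M).

HB.instance Definition _ := Choice.on CL.

Definition clfun (f : CL) : M -> 'cV[R[i]]_d := f : continuousType _ _.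
Coercion clfun : CLambda >-> Funclass.

Lemma clP (f g : CL) : f =1 g -> f = g.
Proof. by move/continuousEP. Qed.

Lemma cl_cont (f : CL) : continuous f.
Proof. exact: (@cts_fun _ _ (f : continuousType _ _)). Qed.

Lemma cl_zero_cont : continuous (fun _ : M => 0 : 'cV[R[i]]_d).
Proof. exact: cst_continuous. Qed.
Definition cl_zero : CL := (mkcts cl_zero_cont : continuousType _ _).

Lemma cl_one_cont : continuous (fun _ : M => pprod1 R[i] d).
Proof. exact: cst_continuous. Qed.
Definition cl_one : CL := (mkcts cl_one_cont : continuousType _ _).

Lemma cl_opp_cont (f : CL) : continuous (fun x => - f x).
Proof. exact: cont_opp (@cl_cont f). Qed.
Definition cl_opp (f : CL) : CL := (mkcts (@cl_opp_cont f) : continuousType _ _).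

Lemma cl_add_cont (f g : CL) : continuous (fun x => f x + g x).
Proof. exact: cont_add (@cl_cont f) (@cl_cont g). Qed.
Definition cl_add (f g : CL) : CL :=
  (mkcts (@cl_add_cont f g) : continuousType _ _).

Lemma cl_scale_cont c (f : CL) : continuous (fun x => c *: f x).
Proof. exact: cont_scale (@cl_cont f). Qed.
Definition cl_scale c (f : CL) : CL :=
  (mkcts (@cl_scale_cont c f) : continuousType _ _).

Lemma cl_mul_cont (f g : CL) :
  continuous (fun x : M => pprod lam (val x) (f x) (g x)).
Proof.
apply: cont_pprod (@cl_cont f) (@cl_cont g); exact: initial_continuous.
Qed.
Definition cl_mul (f g : CL) : CL :=
  (mkcts (@cl_mul_cont f g) : continuousType _ _).

Lemma cl_addA : associative cl_add.
Proof. by move=> f g h; apply: clP => x; exact: addrA. Qed.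
Lemma cl_addC : commutative cl_add.
Proof. by move=> f g; apply: clP => x; exact: addrC. Qed.
Lemma cl_add0 : left_id cl_zero cl_add.
Proof. by move=> f; apply: clP => x; exact: add0r. Qed.
Lemma cl_addN : left_inverse cl_zero cl_opp cl_add.
Proof. by move=> f; apply: clP => x; exact: addNr. Qed.
HB.instance Definition _ :=
  GRing.isZmodule.Build CL cl_addA cl_addC cl_add0 cl_addN.

Lemma cl_mulA : associative cl_mul.
Proof. by move=> f g h; apply: clP => x; exact: pprodA. Qed.
Lemma cl_mulC : commutative cl_mul.
Proof. by move=> f g; apply: clP => x; exact: pprodC. Qed.
Lemma cl_mul1 : left_id cl_one cl_mul.
Proof. by move=> f; apply: clP => x; exact: pprod1l. Qed.
Lemma cl_mulD : left_distributive cl_mul cl_add.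
Proof. by move=> f g h; apply: clP => x; exact: pprodDl. Qed.
HB.instance Definition _ :=
  GRing.Zmodule_isComPzRing.Build CL cl_mulA cl_mulC cl_mul1 cl_mulD.

Lemma cl_mulE (f g : CL) w : (f * g) w = pprod lam (val w) (f w) (g w).
Proof. by []. Qed.
Lemma cl_oneE w : (1 : CL) w = const_mx 1.
Proof. by []. Qed.
Lemma cl_subE (f g : CL) w : (f - g) w = f w - g w.
Proof. by []. Qed.

Lemma cl_scaleA a b f : cl_scale a (cl_scale b f) = cl_scale (a * b) f.
Proof. by apply: clP => x; exact: scalerA. Qed.
Lemma cl_scale1 : left_id 1 cl_scale.
Proof. by move=> f; apply: clP => x; exact: scale1r. Qed.
Lemma cl_scaleDr : right_distributive cl_scale cl_add.
Proof. by move=> a f g; apply: clP => x; exact: scalerDr. Qed.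
Lemma cl_scaleDl f : {morph cl_scale^~ f : a b / a + b >-> cl_add a b}.
Proof. by move=> a b; apply: clP => x; exact: scalerDl. Qed.
HB.instance Definition _ := GRing.Zmodule_isLmodule.Build R[i] CL
  cl_scaleA cl_scale1 cl_scaleDr cl_scaleDl.

(* The instances above do not include [lalgType], which asks for [1 != 0];    *)
(* this is the remaining axiom of an algebra.                                 *)
Lemma cl_scaleAl (a : R[i]) (f g : CL) : a *: (f * g) = (a *: f) * g.
Proof. by apply: clP => x; rewrite /clfun/=; symmetry; exact: pprodZl. Qed.

(* Suprema below are maxima, resp. finite, when [M] is compact and nonempty.  *)
Definition cl_maxnorm (f : CL) : R :=
  sup [set \big[Num.max/0]_j Normc.normc (f w j 0) | w in [set: M]].

Definition cl_norm (f : CL) : R :=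
  sup [set cl_maxnorm (f * g) | g in [set g | cl_maxnorm g <= 1]].

End CLambda.

Section MatrixFunctions.
Variables (F : fieldType) (n : nat).
Implicit Types (B T : 'M[F]_n) (D : 'rV[F]_n) (phi : F -> F).

(* [phi(B) = T phi(D) T^-1] for a chosen diagonalization [B = T D T^-1];      *)
(* [mxfunE] shows that the choice is immaterial.                              *)
Definition diagonalization B : set ('M[F]_n * 'rV[F]_n) :=
  [set TD | TD.1 \in unitmx /\ B = TD.1 *m diag_mx TD.2 *m invmx TD.1].

Definition mxfun phi B : 'M[F]_n :=
  let TD := xget (1%:M, 0) (diagonalization B) in
  TD.1 *m diag_mx (map_mx phi TD.2) *m invmx TD.1.

Lemma mxfunE phi B T D :
  T \in unitmx -> B = T *m diag_mx D *m invmx T ->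
  mxfun phi B = T *m diag_mx (map_mx phi D) *m invmx T.
Proof.
move=> uT BE; rewrite /mxfun.
have : diagonalization B (xget (1%:M, 0) (diagonalization B)).
  by apply: xgetPex; exists (T, D).
case: (xget _ _) => T' D' /= [/= uT' BE'].
have BT' : B *m T' = T' *m diag_mx D' by rewrite BE' mulmxKV.
have TB : invmx T *m B = diag_mx D *m invmx T by rewrite BE -mulmxA mulKmx.
pose S := invmx T *m T'.
have comS : S *m diag_mx D' = diag_mx D *m S.
  by rewrite /S -mulmxA -BT' mulmxA TB mulmxA.
have comphi : S *m diag_mx (map_mx phi D') = diag_mx (map_mx phi D) *m S.
  apply/matrixP => i j; have /matrixP/(_ i j) := comS.
  rewrite !mul_mx_diag !mul_diag_mx !mxE mulrC => /eqP.
  rewrite -subr_eq0 -mulrBl mulf_eq0 subr_eq0 => /orP[/eqP->|/eqP->].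
    by rewrite mulrC.
  by rewrite mulr0 mul0r.
have TS : T *m S = T' by rewrite mulKVmx.
by rewrite -[X in X *m _ *m _]TS -(mulmxA T) comphi !mulmxA mulmxK.
Qed.

Lemma diagonalizableE B : diagonalizable B <-> diagonalization B !=set0.
Proof.
split=> [[P uP]|[[T D] /= [/= uT ->]]].
  move=> dB; have {dB} : is_diag_mx (conjmx P B) := dB.
  rewrite conjumx// => /diag_mxP[D BE].
  exists (invmx P, D); split; rewrite /= ?unitmx_inv// invmxK -BE.
  by rewrite !mulmxA mulVmx// mul1mx mulmxKV.
exists (invmx T); first by rewrite unitmx_inv.
suff : is_diag_mx (conjmx (invmx T) (T *m diag_mx D *m invmx T)) by [].
rewrite conjVmx//.
by rewrite !mulmxA mulVmx// mul1mx mulmxKV// diag_mx_is_diag.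
Qed.

End MatrixFunctions.

Section MatrixNorm.
Variables (R : realType) (n : nat).

Definition l2norm (x : 'cV[R[i]]_n) : R :=
  Num.sqrt (\sum_i Normc.normc (x i 0) ^+ 2).

Definition opnorm (A : 'M[R[i]]_n) : R :=
  sup [set l2norm (A *m x) | x in [set x | l2norm x <= 1]].

Definition spectrum (A : 'M[R[i]]_n) : set R[i] := [set a | eigenvalue A a].

End MatrixNorm.

Section Chi.
Variables (R : realType) (n d : nat) (A : 'M[R[i]]_n.+1) (lam : 'I_d -> R[i]).

Definition p_spectrum : set R[i] :=
  (fun z => (root_poly lam).[z]) @` spectrum A.

(* [f_j], defined on [p(sigma(A)) = sigma(B)], is extended by [0] to [C]; only *)
(* its values at the eigenvalues of [B] enter [f_j(B)].                        *)
Definition chi (lam_inj : injective lam) (f : CLambda lam_inj p_spectrum)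
    : 'M[R[i]]_n.+1 :=
  \sum_j horner_mx A (delta_poly lam j)
         *m mxfun ('valL_0 (fun w => f w j 0)) (horner_mx A (root_poly lam)).

End Chi.

(* Main.v *)
Require Import Defs.
From mathcomp Require Import all_boot all_order all_algebra.
From mathcomp Require Import ring.
From mathcomp Require Import complex.
From mathcomp Require Import all_classical all_reals all_analysis.

Import Order.TTheory GRing.Theory Num.Theory.

(** Everything happens on the eigenspaces of [B = p(A)].  If [B x = w x], then
    [f_j(B) x = f_j(w) x], so [chi f] acts on [x] as the matrix [L(A)], where
    [L = \sum_j f_j(w) delta_j] is the Lagrange polynomial of the vector [f(w)]
    ([chi_eigenvector]).  This polynomial in [A] commutes with [B], so it
    preserves the eigenspace, and [chi f * chi g] acts on [x] as the product of
    the Lagrange polynomials of [f(w)] and [g(w)].  The polyproduct is made so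
    that this product agrees with the Lagrange polynomial of [(f g)(w)] modulo
    [w - p] ([lagrange_pprod]), and [w - p(A)] kills [x].  Linearity and
    [chi 1 = 1] follow in the same way from linearity of interpolation and from
    [\sum_j delta_j = 1].  Eigenvectors of the diagonalizable matrix [B] span
    the space, so these identities hold everywhere; the eigenvalues [w] that
    occur lie in [p(sigma(A))], where [f] is defined, by the spectral mapping
    theorem ([eigenvalue_horner_mx]).

    For continuity, with [B = T D T^-1] every entry of [chi f] is a fixed linear
    combination of the values of [f], so the operator norm of [chi f] is at most
    a constant times the maximum of [|f_j(w)|].  That maximum is below the
    algebra norm of [f], as one sees by taking [g = 1] in the supremum that
    defines the latter.  Suprema being [0] on unbounded sets, one has to check
    that the sets involved are bounded; here [p(sigma(A))] is finite, and
    the polyproduct is bounded pointwise ([normc_pprod_le]). *)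

Local Open Scope classical_set_scope.
Local Open Scope ring_scope.

(** * Diagonalizable matrices and their eigenvectors *)

Section FunctionalCalculus.
Context {F : fieldType} {n : nat}.
Implicit Types (B X Y : 'M[F]_n) (x : 'cV[F]_n) (phi : F -> F) (w : F).

(** In the coordinates [y = T^-1 x] the equation reads [D_i y_i = w y_i], so
    [y] is supported on the indices with [D_i = w]. *)
Lemma mxfun_eigenvector phi B w x :
  diagonalizable B -> B *m x = w *: x -> mxfun phi B *m x = phi w *: x.
Proof.
move=> /diagonalizableE[[T D] [/= uT BE]] Bx.
rewrite (mxfunE phi uT BE); set y := invmx T *m x.
have Dy : diag_mx D *m y = w *: y.
  by rewrite /y scalemxAr -Bx BE !mulmxA mulVmx// mul1mx.
have phiDy : diag_mx (map_mx phi D) *m y = phi w *: y.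
  apply/colP => i; have /colP/(_ i) := Dy.
  rewrite !mul_diag_mx !mxE => /eqP; rewrite -subr_eq0 -mulrBl mulf_eq0 subr_eq0.
  by case/orP=> /eqP ->; rewrite ?mulr0.
by rewrite -!mulmxA -/y phiDy -scalemxAr /y mulmxA mulmxV// mul1mx.
Qed.

(** The columns of the diagonalizing matrix [T] are eigenvectors and form a basis.
    That the diagonal entries are eigenvalues is seen on the rows of [T^-1], as
    [eigenvalue] is about left eigenvectors. *)
Lemma eq_mx_on_eigenvectors {B X Y} : diagonalizable B ->
  (forall w x, eigenvalue B w -> B *m x = w *: x -> X *m x = Y *m x) -> X = Y.
Proof.
move=> /diagonalizableE[[T D] [/= uT BE]] XY.
suff XYT : X *m T = Y *m T by rewrite -(mulmxK uT X) XYT mulmxK.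
apply/matrixP => k i.
have BT : B *m T = T *m diag_mx D by rewrite BE mulmxKV.
have Bi : B *m col i T = D 0 i *: col i T.
  rewrite !colE mulmxA BT -!colE; apply/colP => l.
  by rewrite mul_mx_diag !mxE mulrC.
have ei : eigenvalue B (D 0 i).
  apply/eigenvalueP; exists (row i (invmx T)).
    rewrite -row_mul BE -mulmxA mulKmx//; apply/rowP => l.
    by rewrite mul_diag_mx !mxE.
  apply/eqP => r0; have /rowP/(_ i) : row i (invmx T *m T) = 0.
    by rewrite row_mul r0 mul0mx.
  by rewrite mulVmx// !mxE eqxx => /eqP; rewrite oner_eq0.
have /colP/(_ k) := XY _ _ ei Bi.
by rewrite colE !mulmxA -!colE !mxE.
Qed.

End FunctionalCalculus.

(** Spectral mapping: [p(A) - b] is, up to a nonzero scalar, the product of the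
    [A - z] over the roots [z] of [p - b].  It is singular, so one factor is. *)
Lemma eigenvalue_horner_mx {C : closedFieldType} {n : nat} {A : 'M[C]_n.+1}
    {p : {poly C}} {b : C} :
  (1 < size p)%N -> eigenvalue (horner_mx A p) b ->
  exists2 a, eigenvalue A a & b = p.[a].
Proof.
move=> sp /eigenvalueP[v vb v0].
pose q := p - b%:P.
have q0 : lead_coef q != 0.
  rewrite lead_coef_eq0 subr_eq0; apply: contraTneq sp => ->.
  by rewrite -leqNgt size_polyC_leq1.
have vq : v *m horner_mx A q = 0.
  by rewrite rmorphB/= horner_mx_C mulmxBr vb mul_mx_scalar subrr.
have [r qE] := closed_field_poly_normal q.
have [/hasP[a ar aA]|/hasPn nr] := boolP (has (eigenvalue A) r).
  exists a => //; apply/eqP; rewrite eq_sym -subr_eq0.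
  have : root q a by rewrite qE rootZ// root_prod_XsubC.
  by rewrite /root !hornerE.
pose rA := \prod_(z <- r) (A - z%:M).
have urA : rA \in unitmx.
  apply: unitr_prod_in => z /nr + _; rewrite /eigenvalue negbK kermx_eq0.
  by rewrite row_free_unit.
have vrA : v *m rA = 0.
  apply/eqP; move/eqP: vq; rewrite qE horner_mxZ -scalemxAr scaler_eq0.
  rewrite (negPf q0) rmorph_prod/=; congr (_ *m _ == _); apply: eq_bigr => z _.
  by rewrite rmorphB/= horner_mx_X horner_mx_C.
by move: v0; rewrite -(mulmxK urA v) vrA mul0mx eqxx.
Qed.

(** * Lagrange interpolation and the polyproduct *)

Section LagrangeInterpolation.
Context {F : fieldType} {d : nat}.
Variable lam : 'I_d -> F.
Implicit Types (u v : 'cV[F]_d) (w : F).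

Definition lagrange u : {poly F} := \sum_j u j 0 *: delta_poly lam j.

Lemma lagrange_linear : linear lagrange.
Proof.
move=> c u v; rewrite /lagrange scaler_sumr -big_split/=.
by apply: eq_bigr => j _; rewrite !mxE scalerDl scalerA.
Qed.

(** The polyproduct at [w] is multiplication of interpolation polynomials modulo
    [p - w]: in [delta_sum_mul] one may replace [p] by [w]. *)
Lemma lagrange_pprod u v w : injective lam -> exists Q,
  lagrange u * lagrange v
    = lagrange (pprod lam w u v) + Q * (w%:P - root_poly lam).
Proof.
move=> lam_inj; rewrite [X in exists Q, X = _]delta_sum_mul//.
set s := \sum_j _ *: _; set t : {poly F} := \sum_j (\sum_(k | _) _) *: _.
have -> : lagrange (pprod lam w u v) = s - w%:P * t.
  rewrite mul_polyC /t scaler_sumr -sumrB; apply: eq_bigr => j _.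
  by rewrite mxE scalerBl scalerA.
by exists t; ring.
Qed.

(** The sum [E] of the [delta_j] is idempotent by [delta_sum_mul], whose correction
    term vanishes for constant vectors; it does not vanish at a root of [p], and
    the polynomials form an integral domain. *)
Lemma lagrange1 : (0 < d)%N -> injective lam -> lagrange (pprod1 F d) = 1.
Proof.
move=> d0 lam_inj; set E := lagrange _.
have EE : E * E = E.
  rewrite [LHS]delta_sum_mul// [X in _ - _ * X]big1 ?mulr0 ?subr0 => [|j _].
    by apply: eq_bigr => j _; rewrite !mxE mulr1.
  by rewrite big1 ?scale0r// => k _; rewrite !mxE subrr mulr0 mul0r.
have EC : E.[lam (Ordinal d0)] != 0.
  rewrite horner_sum (bigD1 (Ordinal d0))//= big1 => [|j j0].
    rewrite addr0 mxE scale1r horner_prod; apply/prodf_neq0 => k k0.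
    rewrite hornerZ hornerXsubC mulVf ?oner_eq0// subr_eq0.
    by rewrite (inj_eq lam_inj) eq_sym.
  rewrite hornerZ horner_prod (bigD1 (Ordinal d0)) 1?eq_sym//=.
  by rewrite hornerZ hornerXsubC subrr !(mulr0, mul0r).
have E0 : E != 0 by apply: contraNneq EC => ->; rewrite horner0.
by apply: (mulfI E0); rewrite mulr1.
Qed.

End LagrangeInterpolation.

(** * The homomorphism property *)

Section ChiAlgebra.
Context {R : realType} {n d : nat} {A : 'M[R[i]]_n.+1} {lam : 'I_d -> R[i]}.
Context {lam_inj : injective lam}.
Local Notation p := (root_poly lam).
Local Notation B := (horner_mx A p).
Local Notation CL := (CLambda lam_inj (p_spectrum A lam)).
Implicit Types (f g : CL) (x : 'cV[R[i]]_n.+1).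

Lemma valL_val {U V : Type} {E : set U} (a : V) (phi : E -> V) (w : E) :
  'valL_a phi (val w) = phi w.
Proof. by have /(congr1 (fun h => h w)) := valLK a phi. Qed.

Lemma set_type_val {U : Type} {E : set U} {z : U} :
  E z -> exists w : E, val w = z.
Proof. by move=> /mem_set zE; exists (SigSub zE). Qed.

Lemma chi_eigenvector f (w : p_spectrum A lam) x : diagonalizable B ->
  B *m x = val w *: x ->
  chi f *m x = horner_mx A (lagrange lam (f w)) *m x.
Proof.
move=> diagB Bx; rewrite /chi /lagrange linear_sum/= !mulmx_suml.
apply: eq_bigr => j _; rewrite -mulmxA (mxfun_eigenvector _ _ _ _ diagB Bx).
by rewrite valL_val horner_mxZ -scalemxAr -scalemxAl.
Qed.

Lemma p_spectrum_eigenvalue (z : R[i]) :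
  (0 < d)%N -> eigenvalue B z -> p_spectrum A lam z.
Proof.
move=> d0 /eigenvalue_horner_mx[|a aA ->]; last by exists a.
by rewrite /root_poly size_prod_XsubC /index_enum -enumT size_enum_ord.
Qed.

Lemma eq_mx_on_p_spectrum (X Y : 'M[R[i]]_n.+1) :
  (0 < d)%N -> diagonalizable B ->
  (forall (w : p_spectrum A lam) x, B *m x = val w *: x -> X *m x = Y *m x) ->
  X = Y.
Proof.
move=> d0 diagB XY; apply: (eq_mx_on_eigenvectors diagB) => z x ez Bx.
have [w wz] := set_type_val (p_spectrum_eigenvalue _ d0 ez).
by apply: (XY w); rewrite wz.
Qed.

Lemma chi_linear : (0 < d)%N -> diagonalizable B ->
  linear (@chi R n d A lam lam_inj).
Proof.
move=> d0 diagB c f g; apply: eq_mx_on_p_spectrum => // w x Bx.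
rewrite (chi_eigenvector (c *: f + g) _ _ diagB Bx).
rewrite [RHS]mulmxDl -[X in _ = X + _]scalemxAl.
rewrite [X in _ = _ *: X + _](chi_eigenvector f _ _ diagB Bx).
rewrite [X in _ = _ + X](chi_eigenvector g _ _ diagB Bx).
rewrite [clfun _ w](_ : _ = c *: f w + g w)//.
by rewrite lagrange_linear rmorphD/= horner_mxZ mulmxDl scalemxAl.
Qed.

Lemma chi1 : (0 < d)%N -> diagonalizable B -> chi (1 : CL) = 1.
Proof.
move=> d0 diagB; apply: eq_mx_on_p_spectrum => // w x Bx.
by rewrite (chi_eigenvector _ _ _ diagB Bx) cl_oneE lagrange1// rmorph1.
Qed.

Lemma chiM f g : (0 < d)%N -> diagonalizable B -> chi (f * g) = chi f * chi g.
Proof.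
move=> d0 diagB; apply: eq_mx_on_p_spectrum => // w x Bx.
rewrite (chi_eigenvector (f * g) _ _ diagB Bx).
rewrite [clfun _ w](_ : _ = pprod lam (val w) (f w) (g w))//.
rewrite -[in RHS]mulmxE -[RHS]mulmxA.
rewrite [X in _ = _ *m X](chi_eigenvector g _ _ diagB Bx).
set L := lagrange lam (f w); set L' := lagrange lam (g w).
(* [g(w)] acts within the eigenspace, so [chi f] can be computed on the result. *)
have Bgx : B *m (horner_mx A L' *m x) = val w *: (horner_mx A L' *m x).
  by rewrite mulmxA mulmxE -rmorphM mulrC rmorphM -mulmxE -mulmxA Bx scalemxAr.
rewrite [RHS](chi_eigenvector _ _ _ diagB Bgx) [RHS]mulmxA mulmxE -rmorphM/=.
have [Q ->] := lagrange_pprod lam (f w) (g w) (val w) lam_inj.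
rewrite rmorphD rmorphM rmorphB/= mulmxDl horner_mx_C -[X in _ + X]mulmxA.
by rewrite mulmxBl mul_scalar_mx Bx subrr mulmx0 addr0.
Qed.

End ChiAlgebra.

(** * Bounds for the norms *)

Section Bounds.
Context {R : realType}.
Local Notation normc := (@Normc.normc R).

Lemma normc_ge0 z : 0 <= normc z.
Proof. by case: z => a b; exact: sqrtr_ge0. Qed.

Lemma normc_sum (I : Type) (r : seq I) (P : pred I) (F : I -> R[i]) :
  normc (\sum_(i <- r | P i) F i) <= \sum_(i <- r | P i) normc (F i).
Proof.
elim/big_ind2: _ => [|x a y b xa yb|//]; first by rewrite Normc.normc0.
by rewrite (le_trans (le_normcD _ _))// lerD.
Qed.

Lemma sqrt_sum_sqr_le (I : Type) (r : seq I) (a : I -> R) :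
  (forall i, 0 <= a i) ->
  Num.sqrt (\sum_(i <- r) a i ^+ 2) <= \sum_(i <- r) a i.
Proof.
move=> a0; have s0 : 0 <= \sum_(i <- r) a i by exact: sumr_ge0.
rewrite -[leRHS]ger0_norm// -sqrtr_sqr ler_sqrt ?sqr_ge0//.
elim: r {s0} => [|k r IH]; first by rewrite !big_nil expr0n.
rewrite !big_cons sqrrD -addrA lerD2l (le_trans IH)// lerDr.
by rewrite mulrn_wge0// mulr_ge0// sumr_ge0.
Qed.

(** Each coordinate of a vector in the unit ball has modulus at most [1], and the
    Euclidean norm is below the sum of the moduli of the coordinates. *)
Lemma opnorm_le_sum {n : nat} (X : 'M[R[i]]_n) :
  opnorm X <= \sum_k \sum_l normc (X k l).
Proof.
apply: ge_sup.
  exists (l2norm (X *m 0)), 0 => //=.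
  rewrite /l2norm big1 ?sqrtr0// => k _.
  by rewrite mxE Normc.normc0 expr0n.
move=> _ [x /= x1 <-].
have xl l : normc (x l 0) <= 1.
  apply: le_trans x1; rewrite -[leLHS]ger0_norm ?normc_ge0// -sqrtr_sqr ler_sqrt.
    by rewrite (bigD1 l)//= lerDl sumr_ge0// => k _; rewrite sqr_ge0.
  by rewrite sumr_ge0// => k _; rewrite sqr_ge0.
apply: le_trans (sqrt_sum_sqr_le _ _ _ _) _ => [k|]; first exact: normc_ge0.
apply: ler_sum => k _; rewrite mxE (le_trans (normc_sum _ _ _ _))//.
apply: ler_sum => l _; rewrite Normc.normcM -[leRHS]mulr1.
by rewrite ler_wpM2l ?normc_ge0.
Qed.

(** The sum of the absolute values of the finitely many values is a bound that also
    covers the empty set. *)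
Lemma finite_set_bounded {U : Type} {M : set U} (phi : M -> R) :
  finite_set M -> exists C, forall w, phi w <= C.
Proof.
move=> finM; have := finite_image ('valL_0 phi) finM.
move=> /finite_seqP[s sE]; exists (\sum_(x <- s) `|x|) => w.
have : phi w \in s.
  have : [set` s] (phi w); last by [].
  by rewrite -sE; exists (val w); [exact: set_valP|rewrite valL_val].
move=> /(big_rem _) ->/=.
by rewrite (le_trans (ler_norm _))// lerDl sumr_ge0.
Qed.

Lemma finite_p_spectrum {n d : nat} (A : 'M[R[i]]_n.+1) (lam : 'I_d -> R[i]) :
  finite_set (p_spectrum A lam).
Proof.
apply: finite_image.
have [r rE] := closed_field_poly_normal (char_poly A).
apply: sub_finite_set (finite_seq r) => a.
rewrite /spectrum/= eigenvalue_root_char rE rootZ ?root_prod_XsubC//.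
by rewrite lead_coef_eq0 monic_neq0 ?char_poly_monic.
Qed.

Section FiniteDomain.
Context {d : nat} {lam : 'I_d -> R[i]} {lam_inj : injective lam} {M : set R[i]}.
Hypothesis finM : finite_set M.
Local Notation CL := (CLambda lam_inj M).
Implicit Types (f g h : CL).

Lemma le_bigmax_cl_maxnorm f (w : M) :
  \big[Num.max/0]_j normc (f w j 0) <= cl_maxnorm f.
Proof.
apply: ub_le_sup; last by exists w.
have [C CP] :=
  finite_set_bounded (fun w : M => \big[Num.max/0]_j normc (f w j 0)) finM.
by exists C => _ [v _ <-]; exact: CP.
Qed.

Lemma le_cl_maxnorm f (w : M) j : normc (f w j 0) <= cl_maxnorm f.
Proof. by apply: le_trans (le_bigmax_cl_maxnorm f w); exact: le_bigmax. Qed.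

Lemma cl_maxnorm_ge0 f : 0 <= cl_maxnorm f.
Proof.
have [S0|/set0P[w _]] := eqVneq [set: M] set0.
  by rewrite /cl_maxnorm S0 image_set0 sup0.
by apply: le_trans (le_bigmax_cl_maxnorm f w); exact: bigmax_ge_id.
Qed.

Lemma cl_maxnorm_le f (C : R) : 0 <= C ->
  (forall (w : M) j, normc (f w j 0) <= C) -> cl_maxnorm f <= C.
Proof.
move=> C0 fC; rewrite /cl_maxnorm; set S := (S in sup S).
have [->|/set0P S0] := eqVneq S set0; first by rewrite sup0.
by apply: ge_sup => // _ [w _ <-]; apply: bigmax_le.
Qed.

(** Each difference [u_i - u_j], [v_i - v_j] in the correction term costs a factor
    [2], which accounts for the constant [4]. *)
Lemma normc_pprod_le (w : R[i]) (u v : 'cV[R[i]]_d) (i : 'I_d) (a b : R) :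
  (forall j, normc (u j 0) <= a) -> (forall j, normc (v j 0) <= b) ->
  normc (pprod lam w u v i 0) <= a * b * (1 + normc w *
    \sum_j 4 * normc ((root_poly lam)^`().[lam j] * (lam i - lam j))^-1).
Proof.
move=> ua vb; have a0 : 0 <= a by exact: le_trans (normc_ge0 _) (ua i).
have b0 : 0 <= b by exact: le_trans (normc_ge0 _) (vb i).
have nB (x y : R[i]) (c : R) :
    normc x <= c -> normc y <= c -> normc (x - y) <= c *+ 2.
  by move=> xc yc; rewrite (le_trans (le_normcD _ _))// normcN mulr2n lerD.
rewrite mxE mulrDr mulr1 (le_trans (le_normcD _ _))// normcN lerD//.
  by rewrite Normc.normcM ler_pM ?normc_ge0.
rewrite Normc.normcM mulrCA ler_wpM2l ?normc_ge0// mulr_sumr.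
rewrite (le_trans (normc_sum _ _ _ _))// [leRHS](bigID (fun j => j != i))/=.
rewrite -[leLHS]addr0 lerD//; last first.
  by apply: sumr_ge0 => j _; rewrite !mulr_ge0 ?normc_ge0.
apply: ler_sum => j _; rewrite !Normc.normcM mulrA ler_wpM2r ?normc_ge0//.
apply: le_trans (ler_pM (normc_ge0 _) (normc_ge0 _) (nB _ _ _ (ua i) (ua j))
  (nB _ _ _ (vb i) (vb j))) _.
by rewrite -[a *+ 2]mulr_natr -[b *+ 2]mulr_natr mulrACA -natrM.
Qed.

(** The unit is one of the competitors in the supremum defining [cl_norm f], which
    is finite because multiplication by [f] is bounded. *)
Lemma cl_maxnorm_le_norm f : cl_maxnorm f <= cl_norm f.
Proof.
apply: ub_le_sup; last first.
  exists 1; last by rewrite mulr1.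
  by apply: cl_maxnorm_le => // w j; rewrite cl_oneE mxE Normc.normc1.
pose K (w : M) := \sum_i (1 + normc (val w) *
  \sum_j 4 * normc ((root_poly lam)^`().[lam j] * (lam i - lam j))^-1).
have [C CP] := finite_set_bounded K finM.
exists (`|cl_maxnorm f| * `|C|) => _ [g /= g1 <-].
apply: cl_maxnorm_le => [|w i]; first by rewrite mulr_ge0.
have fw j : normc (f w j 0) <= `|cl_maxnorm f|.
  exact: le_trans (le_cl_maxnorm _ _ _) (ler_norm _).
have gw j : normc (g w j 0) <= 1 by exact: le_trans (le_cl_maxnorm _ _ _) g1.
rewrite [clfun _ w](_ : _ = pprod lam (val w) (f w) (g w))//.
rewrite (le_trans (normc_pprod_le _ _ _ i _ _ fw gw))//.
rewrite mulr1 ler_wpM2l// (le_trans _ (ler_norm _))// (le_trans _ (CP w))//.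
rewrite /K [leRHS](bigD1 i)//= lerDl sumr_ge0// => k _.
rewrite addr_ge0// mulr_ge0 ?normc_ge0// sumr_ge0// => j _.
by rewrite mulr_ge0 ?normc_ge0.
Qed.

End FiniteDomain.
End Bounds.

(** * Continuity *)

(** With [B = T D T^-1], the entries of [chi f] are linear in the numbers [f_j(D_i)],
    with coefficients that depend only on [A], [lam] and [T]. *)
Lemma opnorm_chi_le {R : realType} {n d : nat} {A : 'M[R[i]]_n.+1}
    {lam : 'I_d -> R[i]} {lam_inj : injective lam} :
  diagonalizable (horner_mx A (root_poly lam)) ->
  exists2 C : R, 0 <= C &
    forall f : CLambda lam_inj (p_spectrum A lam),
      opnorm (chi f) <= C * cl_norm f.
Proof.
move=> /diagonalizableE[[T D] [/= uT BE]].
pose Y j := horner_mx A (delta_poly lam j) *m T.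
exists (\sum_k \sum_l \sum_j \sum_i
    Normc.normc (Y j k i) * Normc.normc (invmx T i l)) => [|f].
  by do 4!(apply: sumr_ge0 => ? _); rewrite mulr_ge0 ?normc_ge0.
apply: le_trans (opnorm_le_sum _) _.
rewrite mulr_suml; apply: ler_sum => k _.
rewrite mulr_suml; apply: ler_sum => l _.
have -> : chi f k l = \sum_j \sum_i
    Y j k i * 'valL_0 (fun w => f w j 0) (D 0 i) * invmx T i l.
  rewrite /chi summxE; apply: eq_bigr => j _.
  rewrite (mxfunE _ uT BE) !mulmxA -/(Y j) mxE; apply: eq_bigr => i _.
  by rewrite mul_mx_diag !mxE.
rewrite (le_trans (normc_sum _ _ _ _))// mulr_suml; apply: ler_sum => j _.
rewrite (le_trans (normc_sum _ _ _ _))// mulr_suml; apply: ler_sum => i _.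
rewrite !Normc.normcM -mulrA [X in _ * X <= _]mulrC mulrA.
rewrite ler_wpM2l ?mulr_ge0 ?normc_ge0//.
have finM := finite_p_spectrum A lam.
apply: le_trans (cl_maxnorm_le_norm finM f).
(* Off [p(sigma(A))] the extension of [f_j] is [0]. *)
rewrite /valL_/= oinv_set_val; case: insubP => [w _ _|_] /=.
  exact: le_cl_maxnorm.
by rewrite [leLHS]Normc.normc0 cl_maxnorm_ge0.
Qed.

Theorem theorem3p3 (R : realType) (n d : nat) (A : 'M[R[i]]_n.+1)
    (lam : 'I_d -> R[i]) (d_gt0 : (0 < d)%N) (lam_inj : injective lam)
    (diagB : diagonalizable (horner_mx A (root_poly lam))) :
  let chiA : CLambda lam_inj (p_spectrum A lam) -> 'M[R[i]]_n.+1 :=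
    @chi R n d A lam lam_inj in
  [/\ linear chiA,
      GRing.monoid_morphism chiA &
      forall (f : CLambda lam_inj (p_spectrum A lam)) (e : R), 0 < e ->
        exists2 t : R, 0 < t &
          forall g : CLambda lam_inj (p_spectrum A lam),
            cl_norm (g - f) < t -> opnorm (chiA g - chiA f) < e].
Proof.
move=> chiA; have chi_lin : linear chiA by exact: chi_linear.
have chiB f g : chiA (g - f) = chiA g - chiA f.
  by rewrite -scaleN1r addrC chi_lin scaleN1r addrC.
split=> //; first by split=> [|f g]; [exact: chi1|exact: chiM].
move=> f e e0; have [C C0 CP] := opnorm_chi_le diagB.
have C1 : 0 < C + 1 by rewrite ltr_wpDl.
(* [C] may be [0], hence [C + 1]. *)
exists (e / (C + 1)) => [|g gf]; first exact: divr_gt0.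
have N0 : 0 <= cl_norm (g - f).
  have finM := finite_p_spectrum A lam.
  exact: le_trans (cl_maxnorm_ge0 finM _) (cl_maxnorm_le_norm finM _).
rewrite -chiB (le_lt_trans (CP _))//.
move: gf; rewrite ltr_pdivlMr// mulrC; apply: le_lt_trans.
by rewrite ler_wpM2r// lerDl.
Qed.
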